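(* Let $B>0$ and let $f$ be an arbitrary (randomized) truthful-in-expectation mechanism for the single-facility location game in $\mathbb{R}^2$ with the $L_1$ distance and doubly-peaked preferences (public locations, private preferred distances bounded by $B$). Then the additive approximation error of $f$ is at least $\frac{nB}{500}$; that is, there is a number of agents $n\ge 1$ such that $$\sup_{I}\ \mathbb{E}_{y\sim f(I)}\big[SC(y,I)-OPT(I)\big]\;\ge\;\frac{nB}{500},$$ where the supremum is over instances $I$ with $n$ agents.
   Context: An instance with $n$ agents is a tuple $I=\langle (x_1,b_1),\dots,(x_n,b_n)\rangle$, where $x_i\in\mathbb{R}^2$ is the publicly known location of agent $i$ and $b_i\in[0,B]$ is its private preferred distance to the facility. The cost of agent $i$ when the facility is at $y\in\mathbb{R}^2$ is $cost(y,(x_i,b_i))=\big|\,\|x_i-y\|_1-b_i\,\big|$. The social cost is $SC(y,I)=\sum_{i=1}^n cost(y,(x_i,b_i))$ and $OPT(I)=\min_{y\in\mathbb{R}^2}SC(y,I)$. A randomized mechanism $f$ maps every instance (with any number of agents) to a probability distribution $f(I)$ on $\mathbb{R}^2$ (the distribution of the facility location). It is truthful-in-expectation if for every instance $I$, every agent $i$ and every misreport $b_i'\in[0,B]$, $\mathbb{E}_{y\sim f(I)}[cost(y,(x_i,b_i))]\le \mathbb{E}_{y\sim f(I')}[cost(y,(x_i,b_i))]$, where $I'$ is $I$ with $(x_i,b_i)$ replaced by $(x_i,b_i')$. *)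

(* Defs.v *)
From mathcomp Require Import all_boot all_order all_algebra.
From mathcomp Require Import all_classical all_reals all_analysis.
Import Order.TTheory GRing.Theory Num.Theory.
Import numFieldNormedType.Exports.

Set Implicit Arguments.
Unset Strict Implicit.
Unset Printing Implicit Defensive.

Local Open Scope classical_set_scope.
Local Open Scope ring_scope.

(* The library's norm on a product is the max norm, hence this explicit L1
   distance. *)
Definition L1dist (R : realType) (x y : R * R) : R :=
  `|x.1 - y.1| + `|x.2 - y.2|.

Definition pref (R : realType) (B : R) : Type := {b : R | 0 <= b <= B}.

Definition agent (R : realType) (B : R) : Type := ((R * R) * pref B)%type.

Definition instance (R : realType) (B : R) (n : nat) : Type :=
  {ffun 'I_n -> agent B}.

Definition cost (R : realType) (B : R) (y : R * R) (a : agent B) : R :=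
  `|L1dist a.1 y - sval a.2|.

Definition SC (R : realType) (B : R) (n : nat) (y : R * R)
    (I : instance B n) : R :=
  \sum_(i < n) cost y (I i).

(* The infimum is a minimum: see OPT_attained. *)
Definition OPT (R : realType) (B : R) (n : nat) (I : instance B n) : R :=
  inf [set SC y I | y in [set: R * R]].

Definition misreport (R : realType) (B : R) (n : nat) (I : instance B n)
    (i : 'I_n) (b : pref B) : instance B n :=
  [ffun j => if j == i then ((I i).1, b) else I j].

(* The Borel sigma-algebra of the plane is the product of those of the two
   factors. *)
Definition mechanism (R : realType) (B : R) : Type :=
  forall n : nat, instance B n ->
    probability (measurableTypeR R * measurableTypeR R)%type R.

(* Expectations of nonnegative functions, valued in the extended reals: both
   sides make sense, possibly as +oo, for every distribution. *)
Definition truthful_in_expectation (R : realType) (B : R)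
    (f : mechanism B) : Prop :=
  forall (n : nat) (I : instance B n) (i : 'I_n) (b' : pref B),
    ('E_(f n I)[fun y => cost y (I i)] <=
     'E_(f n (misreport I i b'))[fun y => cost y (I i)])%E.

Definition additive_error (R : realType) (B : R) (f : mechanism B)
    (n : nat) : \bar R :=
  ereal_sup [set ('E_(f n I)[fun y => (SC y I - OPT I)%R])%E | I in [set: instance B n]].

Section OPT_attained.
Variables (R : realType) (B : R).

Lemma cost_continuous (a : agent B) : continuous (fun y : R * R => cost y a).
Proof.
have nc (c : R) (g : R * R -> R) : continuous g ->
    continuous (fun y => `|c - g y| : R).
  move=> cg y; apply: (@continuous_comp _ _ _ (fun y => c - g y) Num.norm).
    by apply: continuousB; [exact: cst_continuous|exact: cg].
  exact: norm_continuous.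
move=> y; apply: (@continuous_comp _ _ _ (fun y => L1dist a.1 y - sval a.2) Num.norm);
  last exact: norm_continuous.
apply: continuousB; last exact: cst_continuous.
by apply: continuousD; apply: nc => z; [exact: cvg_fst|exact: cvg_snd].
Qed.

Lemma SC_continuous (n : nat) (I : instance B n) :
  continuous (fun y : R * R => SC y I).
Proof.
rewrite /SC; elim: (index_enum _) => [|i s IHs].
  by under eq_fun do rewrite big_nil; exact: cst_continuous.
under eq_fun do rewrite big_cons.
by move=> y; apply: cvgD; [exact: cost_continuous|exact: IHs].
Qed.

Lemma OPT_attained (n : nat) (I : instance B n) :
  exists2 y : R * R, SC y I = OPT I & forall z, SC y I <= SC z I.
Proof.
suff [y ymin] : exists y : R * R, forall z, SC y I <= SC z I.
  exists y => //; apply/eqP; rewrite eq_le; apply/andP; split.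
    by apply: lb_le_inf; [exists (SC y I), y|move=> _ [z _ <-]].
  by apply: ge_inf; [exists (SC y I) => _ [z _ <-]|exists y].
case: n I => [|n] I; first by exists (0, 0) => z; rewrite /SC !big_ord0.
set x := (I ord0).1; set b := sval (I ord0).2.
set r := SC x I + b.
have SC0 z : L1dist x z - b <= SC z I.
  apply: le_trans (ler_norm _) _; rewrite /SC big_ord_recl lerDl.
  by apply: sumr_ge0 => i _; exact: normr_ge0.
have r0 : 0 <= r.
  have /andP[b0 _] := svalP (I ord0).2.
  by apply: addr_ge0 => //; apply: sumr_ge0 => i _; exact: normr_ge0.
pose A := [set` `[x.1 - r, x.1 + r]] `*` [set` `[x.2 - r, x.2 + r]].
have inA z : `|x.1 - z.1| <= r -> `|x.2 - z.2| <= r -> A z.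
  by move=> h1 h2; split; rewrite /= in_itv /= -ler_distlC.
have xA : A x by apply: inA; rewrite subrr normr0.
have [|||y _ ymin] := @compact_EVT_min _ _ (fun y => SC y I) A.
- by exists x.
- by apply: compact_setX; exact: segment_compact.
- exact/continuous_subspaceT/SC_continuous.
exists y => z; have [zA|zA] := pselect (A z); first by apply: ymin; rewrite inE.
apply: le_trans (ymin x _) _; first by rewrite inE.
apply: le_trans (SC0 z); rewrite lerBrDr -/r.
rewrite leNgt; apply/negP => zr; apply: zA; apply: inA.
  by apply: le_trans (ltW zr); rewrite lerDl.
by apply: le_trans (ltW zr); rewrite lerDr.
Qed.

End OPT_attained.

(* Main.v *)
Require Import Defs.
From mathcomp Require Import all_boot all_order all_algebra.
From mathcomp Require Import all_classical all_reals all_analysis.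
From mathcomp Require Import measurable_realfun lra.
Import Order.TTheory GRing.Theory Num.Theory.

Set Implicit Arguments.
Unset Strict Implicit.
Unset Printing Implicit Defensive.

Local Open Scope ring_scope.

(* Put r = B / 2. Two agents at (r, 0) and (-r, 0) with preferred distance B
   pull the facility to one of the points (0, r) and (0, -r), which lie at
   distances 0 and B from two further agents, both at (0, r). When these report
   0 and B the two points are equally good. If the first one reports r / 2
   instead, every near-optimal outcome is near (0, -r); if instead the second
   one reports 3r / 2, every near-optimal outcome is near (0, r). An agent with
   true preference r / 2 (resp. 3r / 2) may misreport 0 (resp. B), so
   truthfulness makes the tied instance costly for both of these preferences:
   if D is the distance from (0, r) to its outcome, E|D - r/2| + E|D - 3r/2| is
   at least about 3r. But |D - r/2| + |D - 3r/2| exceeds 2r only when D > B, by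
   at most the error of that outcome. *)

(** * Expectations of nonnegative random variables *)

Section Expectation.
Context d (T : measurableType d) (R : realType) (P : probability T R).
Implicit Types X Y : T -> R.

(** Nonnegativity stands in for integrability: the outcome distributions may be such that costs have
    expectation [+oo]. *)
Lemma ge0_expectationD X Y :
  measurable_fun setT X -> measurable_fun setT Y ->
  (forall t, 0 <= X t) -> (forall t, 0 <= Y t) ->
  ('E_P[fun t => (X t + Y t)%R] = 'E_P[X] + 'E_P[Y])%E.
Proof.
move=> mX mY X0 Y0; rewrite unlock -ge0_integralD//.
- by move=> t _; rewrite lee_fin.
- exact/measurable_EFinP.
- by move=> t _; rewrite lee_fin.
- exact/measurable_EFinP.
Qed.

Lemma ge0_expectationZl (k : R) X :
  measurable_fun setT X -> (forall t, 0 <= X t) -> 0 <= k ->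
  ('E_P[fun t => (k * X t)%R] = k%:E * 'E_P[X])%E.
Proof.
move=> mX X0 k0; rewrite unlock -ge0_integralZl_EFin//.
- by move=> t _; rewrite lee_fin.
- exact/measurable_EFinP.
Qed.

Lemma ge0_expectation_le X Y :
  measurable_fun setT X -> measurable_fun setT Y ->
  (forall t, 0 <= X t) -> (forall t, X t <= Y t) -> ('E_P[X] <= 'E_P[Y])%E.
Proof.
move=> mX mY X0 XY; apply: expectation_le => //; last exact: aeW.
by move=> t; exact: le_trans (XY t).
Qed.

End Expectation.

(** * Measurability and errors of outcomes *)

Section Game.
Context (R : realType) (B : R).

Lemma cost_ge0 (y : R * R) (a : agent B) : 0 <= cost y a.
Proof. exact: normr_ge0. Qed.

Lemma measurable_cost (a : agent B) :
  measurable_fun [set: measurableTypeR R * measurableTypeR R]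
    (fun y => cost (y : R * R) a).
Proof.
have coord (c : R) (g : measurableTypeR R * measurableTypeR R -> R) :
    measurable_fun setT g -> measurable_fun setT (fun y => `|c - g y|).
  by move=> mg; apply: measurableT_comp => //; exact: measurable_funB.
apply: measurableT_comp => //; apply: measurable_funB => //.
by apply: measurable_funD; apply: coord;
  [exact: measurable_fst|exact: measurable_snd].
Qed.

Lemma measurable_SC n (I : instance B n) :
  measurable_fun [set: measurableTypeR R * measurableTypeR R]
    (fun y => SC (y : R * R) I).
Proof. by apply: measurable_sum => i; exact: measurable_cost. Qed.

Lemma OPT_le_SC n (I : instance B n) z : OPT I <= SC z I.
Proof. by have [y <- ] := OPT_attained I; exact. Qed.

Lemma measurable_error n (I : instance B n) :
  measurable_fun [set: measurableTypeR R * measurableTypeR R]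
    (fun y => SC (y : R * R) I - OPT I).
Proof. by apply: measurable_funB => //; exact: measurable_SC. Qed.

Lemma expected_error_le (f : mechanism B) n (I : instance B n) :
  ('E_(f n I)[fun y => (SC y I - OPT I)%R] <= additive_error f n)%E.
Proof. by apply: ereal_sup_ubound; exists I. Qed.

End Game.

Lemma norm_bounds (R : realType) (x : R) : (- x <= `|x|) && (x <= `|x|).
Proof. by rewrite ler_norm -normrN ler_norm. Qed.

(** Innermost absolute values are split first, so that nested ones become linear; [prune] runs after
    each split to discard contradictory sign patterns before they multiply. *)
Ltac split_norms prune :=
  repeat match goal with |- context [`|?x|] =>
    lazymatch x with
    | context [`|_|] => fail
    | _ => case: (ger0P x) => ?; prune
    end end.

(* For goals monotone in the outer absolute values: splitting only the inner
   ones keeps the number of cases small. *)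
Ltac bound_norms :=
  repeat match goal with |- context [`|?x|] =>
    lazymatch x with
    | context [`|_|] =>
      case/andP: (norm_bounds x); move: `|x| => ?
    end end;
  split_norms idtac.

(** * The four-agent instances *)

Section Tetrad.
Context (R : realType) (B : R) (hB : 0 < B).
Let r := B / 2.

Fact in_pref0 : (0 : R) <= 0 <= B. Proof. by rewrite lexx ltW. Qed.
Fact in_prefB : 0 <= B <= B. Proof. by rewrite lexx ltW. Qed.
Fact in_pref_near : 0 <= r / 2 <= B.
Proof. by apply/andP; split; rewrite /r; move: hB; lra. Qed.
Fact in_pref_far : 0 <= 3 * r / 2 <= B.
Proof. by apply/andP; split; rewrite /r; move: hB; lra. Qed.

Definition pref0 : pref B := exist _ 0 in_pref0.
Definition prefB : pref B := exist _ B in_prefB.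
Definition pref_near : pref B := exist _ (r / 2) in_pref_near.
Definition pref_far : pref B := exist _ (3 * r / 2) in_pref_far.

Definition voter (s : pref B) : agent B := ((0, r), s).

Definition tetrad (s t : pref B) : instance B 4 :=
  [ffun i => tnth [tuple ((- r, 0), prefB); ((r, 0), prefB);
                         voter s; voter t] i].

Definition voter1 : 'I_4 := inord 2.
Definition voter2 : 'I_4 := inord 3.

Lemma tetrad_voter1 s t : tetrad s t voter1 = voter s.
Proof. by rewrite ffunE (tnth_nth (voter s)) inordK. Qed.

Lemma tetrad_voter2 s t : tetrad s t voter2 = voter t.
Proof. by rewrite ffunE (tnth_nth (voter s)) inordK. Qed.

Lemma misreport_voter1 s s' t :
  misreport (tetrad s t) voter1 s' = tetrad s' t.
Proof.
apply/ffunP => j; rewrite ffunE tetrad_voter1; case: eqP => [->|/eqP].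
  by rewrite tetrad_voter1.
rewrite -val_eqE /= inordK// !ffunE !(tnth_nth (voter s)).
by case: j => -[|[|[|[|]]]].
Qed.

Lemma misreport_voter2 s t t' :
  misreport (tetrad s t) voter2 t' = tetrad s t'.
Proof.
apply/ffunP => j; rewrite ffunE tetrad_voter2; case: eqP => [->|/eqP].
  by rewrite tetrad_voter2.
rewrite -val_eqE /= inordK// !ffunE !(tnth_nth (voter s)).
by case: j => -[|[|[|[|]]]].
Qed.

Lemma SC_tetrad y s t : SC y (tetrad s t) =
  `| `|- r - y.1| + `|y.2| - B| + `| `|r - y.1| + `|y.2| - B|
  + cost y (voter s) + cost y (voter t).
Proof.
rewrite /SC !big_ord_recl big_ord0 !ffunE !(tnth_nth (voter s)) /=.
by rewrite /cost /L1dist /= !sub0r !normrN addr0 !addrA.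
Qed.

(** Upper bounds on the optima suffice, since they bound errors from below. The witnesses here and
    below are the points (0, r) and (0, -r), where the first two agents have cost 0. *)
Lemma OPT_tied : OPT (tetrad pref0 prefB) <= 2 * r.
Proof.
apply: le_trans (OPT_le_SC _ (0, r)) _.
rewrite SC_tetrad /cost /L1dist /= /r; move: hB => ?.
split_norms ltac:(try (exfalso; lra)); lra.
Qed.

Lemma OPT_near : OPT (tetrad pref_near prefB) <= 3 * r / 2.
Proof.
apply: le_trans (OPT_le_SC _ (0, - r)) _.
rewrite SC_tetrad /cost /L1dist /= /r; move: hB => ?.
split_norms ltac:(try (exfalso; lra)); lra.
Qed.

Lemma OPT_far : OPT (tetrad pref0 pref_far) <= 3 * r / 2.
Proof.
apply: le_trans (OPT_le_SC _ (0, r)) _.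
rewrite SC_tetrad /cost /L1dist /= /r; move: hB => ?.
split_norms ltac:(try (exfalso; lra)); lra.
Qed.

(** The voters alone give this: |D - r/2| + |D - 3r/2| <= D + |D - B| for D >= 0, and the costs [G1]
    and [G2] of the other two agents only add to the right side. *)
Lemma cost_tied y :
  cost y (voter pref_near) + cost y (voter pref_far) <=
  2 * r + (SC y (tetrad pref0 prefB) - OPT (tetrad pref0 prefB)).
Proof.
have o_le := OPT_tied; rewrite SC_tetrad /cost /L1dist /=.
set G1 := `|_ + `|y.2| - B|; set G2 := `|_ + `|y.2| - B|.
set D := _ + `|_ - y.2|.
have D0 : 0 <= D by apply: addr_ge0.
have G10 : 0 <= G1 := normr_ge0 _; have G20 : 0 <= G2 := normr_ge0 _.
move: o_le hB D0 G10 G20; rewrite /r; move: D G1 G2 => D G1 G2 *.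
split_norms idtac; lra.
Qed.

(** The factor 3 is attained at (r/4, 3r/4), where the voter has cost 0 and the error is r/2. *)
Lemma cost_near y :
  3 * r / 2 <= cost y (voter pref_near) +
  3 * (SC y (tetrad pref_near prefB) - OPT (tetrad pref_near prefB)).
Proof.
move: OPT_near; set o := OPT _.
rewrite SC_tetrad /cost /L1dist /= /r; move: hB => ? ?; bound_norms; lra.
Qed.

Lemma cost_far y :
  3 * r / 2 <= cost y (voter pref_far) +
  3 * (SC y (tetrad pref0 pref_far) - OPT (tetrad pref0 pref_far)).
Proof.
move: OPT_far; set o := OPT _.
rewrite SC_tetrad /cost /L1dist /= /r; move: hB => ? ?; bound_norms; lra.
Qed.

Let Plane := (measurableTypeR R * measurableTypeR R)%type.

Lemma expected_cost_tied (P : probability Plane R) :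
  ('E_P[fun y => cost y (voter pref_near)] +
   'E_P[fun y => cost y (voter pref_far)] <=
   (2 * r)%:E +
   'E_P[fun y => (SC y (tetrad pref0 prefB) - OPT (tetrad pref0 prefB))%R])%E.
Proof.
have r0 : 0 <= 2 * r by rewrite /r; move: hB; lra.
have m_near := measurable_cost (voter pref_near).
have m_far := measurable_cost (voter pref_far).
have m_err := measurable_error (tetrad pref0 prefB).
have err0 y : 0 <= SC y (tetrad pref0 prefB) - OPT (tetrad pref0 prefB).
  by rewrite subr_ge0 OPT_le_SC.
(* As [P] has mass 1, the constant is an expectation too; each side becomes a single expectation and
   the pointwise bound applies. *)
rewrite -(expectation_cst P (2 * r)) -!ge0_expectationD//;
  try by move=> y; exact: cost_ge0.
apply: ge0_expectation_le.
- exact: measurable_funD.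
- by apply: measurable_funD => //; exact: measurable_cst.
- by move=> y; rewrite addr_ge0 ?cost_ge0.
- by move=> y; exact: cost_tied.
Qed.

Lemma expected_cost_untied (P : probability Plane R) (a : agent B)
    (I : instance B 4) :
  (forall y, 3 * r / 2 <= cost y a + 3 * (SC y I - OPT I)) ->
  ((3 * r / 2)%:E <=
   'E_P[fun y => cost y a] + 3%:E * 'E_P[fun y => (SC y I - OPT I)%R])%E.
Proof.
move=> le_cost.
have r0 : 0 <= 3 * r / 2 by rewrite /r; move: hB; lra.
have m_cost := measurable_cost a; have m_err := measurable_error I.
have err0 y : 0 <= SC y I - OPT I by rewrite subr_ge0 OPT_le_SC.
rewrite -ge0_expectationZl// -(expectation_cst P (3 * r / 2)).
rewrite -ge0_expectationD//.
- apply: ge0_expectation_le => //.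
  by apply: measurable_funD => //; exact: measurable_funM.
- exact: measurable_funM.
- by move=> y; exact: cost_ge0.
- by move=> y; rewrite mulr_ge0.
Qed.

End Tetrad.

Theorem theorem7 (R : realType) (B : R) (hB : 0 < B) (f : mechanism B)
    (hf : truthful_in_expectation f) :
  exists n : nat, (1 <= n)%N /\
    ((n%:R * B / 500)%:E <= additive_error f n)%E.
Proof.
exists 4%N; split=> //; rewrite leNgt; apply/negP; set e := _ / 500 => err_lt.
have err_le I : ('E_(f 4%N I)[fun y => (SC y I - OPT I)%R] <= e%:E)%E.
  exact: le_trans (expected_error_le f I) (ltW err_lt).
(* [I] is an untied instance in which [a] is truthful, and [J] the tied one reached by the misreport
   of [a]. *)
have untied (a : agent B) I J :
      (forall y, 3 * (B / 2) / 2 <= cost y a + 3 * (SC y I - OPT I)) ->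
    ('E_(f 4%N I)[fun y => cost y a] <= 'E_(f 4%N J)[fun y => cost y a])%E ->
    ((3 * (B / 2) / 2)%:E <= 'E_(f 4%N J)[fun y => cost y a] + (3 * e)%:E)%E.
  move=> le_cost truth.
  apply: le_trans (expected_cost_untied hB (f 4%N I) le_cost) _.
  by apply: leeD => //; rewrite EFinM lee_pmul2l ?lte_fin ?err_le.
set tied := tetrad hB (pref0 hB) (prefB hB).
have near := untied _ _ tied (cost_near hB).
have far := untied _ _ tied (cost_far hB).
have := hf 4%N (tetrad hB (pref_near hB) (prefB hB)) voter1 (pref0 hB).
rewrite misreport_voter1 tetrad_voter1 => /near{}near.
have := hf 4%N (tetrad hB (pref0 hB) (pref_far hB)) voter2 (prefB hB).
rewrite misreport_voter2 tetrad_voter2 => /far{}far.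
(* With r = B / 2, the bounds combine to 3r <= 2r + e + 6e, hence e >= B / 14, whereas e = 4B / 500
   = B / 125. *)
have := leeD near far; rewrite addeACA => /le_trans sum_le.
have := sum_le _ (leeD (le_trans (expected_cost_tied hB (f 4%N tied))
  (leeD (lexx _) (err_le tied))) (lexx _)).
by rewrite -!EFinD lee_fin /e; have := hB; lra.
Qed.
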